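(* Let $t=t(n)$ be positive integers with $t(n)=o(\log n)$ as $n\to\infty$. Let $X=\{e_1,\dots,e_n\}\subset\mathbb{R}^n$ be the standard basis vectors and let $\Pi\sim\mathcal{J}_{n,t}$. Then, with probability $1-o(1)$ as $n\to\infty$, $$\frac{\min_{c\in X}\sum_{x\in X}\|x-c\|_2^2}{\min_{c'\in\Pi(X)}\sum_{x\in X}\|\Pi(x)-c'\|_2^2}\ \ge\ 2-o(1).$$
   Context: $\mathcal{J}_{d,t}$ denotes the distribution of the linear map $\Pi:\mathbb{R}^d\to\mathbb{R}^t$, $x\mapsto Gx$, where $G$ is a $t\times d$ matrix with i.i.d. $\mathcal{N}(0,1/t)$ entries. The quantity $\min_{c\in X}\sum_{x\in X}\|x-c\|_2^2$ is the $1$-medoid cost of $X$ (the center is restricted to be a point of the set). *)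

(* Defs.v *)
From HB Require Import structures.
From mathcomp Require Import all_boot all_order all_algebra.
From mathcomp Require Import all_classical all_reals all_analysis.

Set Implicit Arguments.
Unset Strict Implicit.
Unset Printing Implicit Defensive.

Import Order.TTheory GRing.Theory Num.Theory.
Import numFieldNormedType.Exports.

Local Open Scope classical_set_scope.
Local Open Scope ring_scope.

(* The library norm `|v| on matrices is the sup norm, hence this definition. *)
Definition norm2 (R : realType) (d : nat) (v : 'cV[R]_d) : R :=
  Num.sqrt (\sum_(i < d) v i ord0 ^+ 2).

Definition mutually_independent (R : realType) (d : measure_display)
    (T : measurableType d) (P : probability T R) (I : finType)
    (X : I -> {RV P >-> R}) : Prop :=
  forall (J : {set I}) (A : I -> set R), (forall i, measurable (A i)) ->
    P (\bigcap_(i in [set` J]) (X i @^-1` A i)) =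
    (\prod_(i in J) P (X i @^-1` A i))%E.

(* normal_prob takes the standard deviation: this is the law N(0, 1/t). *)
Definition jl_entry_law (R : realType) (t : nat) : set R -> \bar R :=
  normal_prob 0 (Num.sqrt (t%:R^-1)).

(* Pi ~ J_(d,t): the random map Pi is x |-> G x, for G a t x d matrix with
   i.i.d. N(0, 1/t) entries. *)
Definition jl_distributed (R : realType) (disp : measure_display)
    (T : measurableType disp) (P : probability T R) (d t : nat)
    (Pi : T -> 'cV[R]_d -> 'cV[R]_t) : Prop :=
  exists G : 'I_t * 'I_d -> {RV P >-> R},
    [/\ mutually_independent G,
        forall (ij : 'I_t * 'I_d) (A : set R), measurable A ->
          distribution P (G ij) A = jl_entry_law t A &
        forall (w : T) (x : 'cV[R]_d),
          Pi w x = (\matrix_(i < t, j < d) G (i, j) w) *m x].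

Definition std_basis (R : realType) (n : nat) : set 'cV[R]_n :=
  [set delta_mx i ord0 | i in [set: 'I_n]].

(* min_(c in C) \sum_(x in X) ||f x - c||^2; it is used for X and C finite and
   (except in dimension 0) nonempty, where the infimum is a minimum. *)
Definition min_cost (R : realType) (d m : nat) (X : set 'cV[R]_d)
    (f : 'cV[R]_d -> 'cV[R]_m) (C : set 'cV[R]_m) : R :=
  inf [set \sum_(x \in X) norm2 (f x - c) ^+ 2 | c in C].

(* Main.v *)
Require Import Defs.
From HB Require Import structures.
From mathcomp Require Import all_boot all_order all_algebra.
From mathcomp Require Import finmap.
From mathcomp Require Import all_classical all_reals all_analysis.
From mathcomp Require Import measurable_realfun.
From mathcomp Require Import ring lra.

Import Order.TTheory GRing.Theory Num.Theory.
Import numFieldNormedType.Exports.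

Local Open Scope classical_set_scope.
Local Open Scope ring_scope.

(* Write [g_j = Pi e_j], [S = \sum_j |g_j|^2] and [D_c = \sum_j |g_j - g_c|^2].
   Before projection every center costs [2(n-1)].  For a small [s]:
   - Chernoff bounds for chi-square variables give [n/4 < S <= (1+s) n] with
     probability exponentially close to 1;
   - each [g_c] satisfies [|g_c| <= s] with probability at least [q^t], where
     [q > 0] depends only on [s]; since [t = o(log n)], [n q^t] tends to
     infinity, so by independence some column [c] is that short with high
     probability.
   For such a [c], AM-GM gives [D_c <= (1+s) S + n (s + s^2)], so the projected
   cost is at most [(1 + O(s)) n].  It is moreover nonzero, which matters because
   a ratio with denominator [0] is [0] here: if some [D_c] vanished then all
   columns would be short and [S <= s^2 n < n/4].  The rate [o(1)] is finally
   extracted from the statements at fixed [s] by a diagonal argument. *)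

(** * Integrals against the normal law *)

(** The Radon-Nikodym derivative of [normal_prob] and the density [normal_pdf] have the same
    integral over every measurable set, hence agree almost everywhere, and either can serve in the
    change of variables. *)
Lemma ge0_integral_normal_prob (R : realType) (m s : R) (f : R -> \bar R) :
  measurable_fun [set: R] f -> (forall x, 0 <= f x)%E ->
  (\int[normal_prob m s]_x f x =
   \int[lebesgue_measure]_x (f x * (normal_pdf m s x)%:E))%E.
Proof.
move=> mf f0; have dom := @normal_prob_dominates R m s.
rewrite -(Radon_Nikodym_SigmaFinite.change_of_variables dom)//.
apply: ae_eq_integral => //.
- apply: emeasurable_funM => //; apply: (measurable_int lebesgue_measure).
  exact: Radon_Nikodym_SigmaFinite.f_integrable.
- apply: emeasurable_funM => //; apply/measurable_EFinP.
  exact: measurable_normal_pdf.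
- apply: ae_eqe_mul2l => /=; apply: integral_ae_eq => //=.
  + exact: Radon_Nikodym_SigmaFinite.f_integrable.
  + by apply/measurable_EFinP; exact: measurable_normal_pdf.
  + by move=> E _ mE; rewrite -Radon_Nikodym_SigmaFinite.f_integral.
Qed.

(* [X] is retyped so that the two measures on the reals carry the same
   [measure_display]. *)
Lemma ge0_integral_comp_normal (R : realType) (d : measure_display)
    (T : measurableType d) (P : probability T R) (X : {RV P >-> R})
    (m s : R) (f : R -> \bar R) :
  (forall A, measurable A -> distribution P X A = normal_prob m s A) ->
  measurable_fun [set: R] f -> (forall x, 0 <= f x)%E ->
  (\int[P]_w f (X w) = \int[normal_prob m s]_x f x)%E.
Proof.
move=> lawX mf f0; pose phi : T -> measurableTypeR R := X.
have mphi : measurable_fun [set: T] phi := measurable_funPT X.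
have := @ge0_integral_pushforward _ _ T (measurableTypeR R) R phi mphi P setT f.
rewrite preimage_setT => <- //.
by apply: eq_measure_integral => A mA _; exact: lawX.
Qed.

(* The integrand times the density is, up to the constant [c^(-1/2)], the
   density of [N(0, s^2 / c)]. *)
Lemma integral_normal_prob_expR_sqr (R : realType) (s c : R) :
  0 < s -> 0 < c ->
  (\int[normal_prob 0 s]_x (expR ((1 - c) * (x ^+ 2 / (s ^+ 2 *+ 2))))%:E =
   ((Num.sqrt c)^-1)%:E)%E.
Proof.
move=> s0 c0; rewrite ge0_integral_normal_prob; last 2 first.
- apply/measurable_EFinP; apply: measurableT_comp => //.
  by apply: measurable_funM => //; apply: measurable_funM.
- by move=> x; rewrite lee_fin expR_ge0.
have q0 : 0 < Num.sqrt c by rewrite sqrtr_gt0.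
have sn0 : s != 0 by rewrite gt_eqF.
pose s' := s / Num.sqrt c.
have s'0 : 0 < s' by rewrite divr_gt0.
have s'n0 : s' != 0 by rewrite gt_eqF.
transitivity (\int[lebesgue_measure]_x
    (((Num.sqrt c)^-1)%:E * (normal_pdf 0 s' x)%:E))%E.
  apply: eq_integral => x _; rewrite -!EFinM; congr (_%:E).
  rewrite !normal_pdfE// mulrCA mulrA /normal_fun !subr0.
  have -> : normal_peak s' = Num.sqrt c * normal_peak s.
    rewrite /normal_peak /s' exprMn exprVn sqr_sqrtr ?ltW//.
    have -> : s ^+ 2 / c * pi *+ 2 = c^-1 * (s ^+ 2 * pi *+ 2) by ring.
    rewrite sqrtrM ?invr_ge0 ?ltW// invfM sqrtrV ?ltW// invrK.
    by [].
  rewrite -!mulrA mulKf ?gt_eqF// -expRD; congr (_ * expR _).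
  rewrite /s' exprMn exprVn sqr_sqrtr ?ltW//.
  by field; rewrite sn0 gt_eqF.
rewrite ge0_integralZl//.
- by rewrite integral_normal_pdf mule1.
- by apply/measurable_EFinP; exact: measurable_normal_pdf.
- by move=> x _; rewrite lee_fin normal_pdf_ge0.
Qed.

(** * Expectations of products of independent variables *)

Import HBNNSimple.

(** Writing [h] as a finite combination of indicators and distributing the product leaves integrals
    of indicators of intersections, which independence factorises; distributivity read backwards
    gives the product of the expectations. *)
Lemma integral_prod_nnsfun (R : realType) (d : measure_display)
    (T : measurableType d) (P : probability T R) (I : finType)
    (X : I -> {RV P >-> R}) (h : {nnsfun R >-> R}) :
  mutually_independent X ->
  (\int[P]_w (\prod_i h (X i w))%:E = \prod_i \int[P]_w (h (X i w))%:E)%E.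
Proof.
move=> indX.
pose s := fset_set (range h); pose m := size s.
pose B (a : 'I_m) : set R := h @^-1` [set s`_a].
have mB a : measurable (B a) by exact: measurable_sfunP.
have s0 (a : 'I_m) : 0 <= s`_a.
  have : s`_a \in s by apply: mem_nth.
  by rewrite in_fset_set// inE => -[x _ <-]; exact: fun_ge0.
have hE x : h x = \sum_(a < m) s`_a * \1_(B a) x by rewrite fimfunEord.
have mXB i a : measurable (X i @^-1` B a).
  by rewrite -[_ @^-1` _]setTI; exact: measurable_funP.
pose p i a := fine (P (X i @^-1` B a)).
have mindic i a : measurable_fun [set: T] (fun w => \1_(B a) (X i w) : R).
  by rewrite (_ : (fun _ => _) = \1_(X i @^-1` B a))//; exact: measurable_indic.
have pE i a : P (X i @^-1` B a) = (p i a)%:E.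
  by rewrite fineK// fin_num_measure.
have intE i : (\int[P]_w (h (X i w))%:E = (\sum_(a < m) s`_a * p i a)%:E)%E.
  under eq_integral do rewrite hE -sumEFin.
  rewrite ge0_integral_sum//; last 2 first.
  - by move=> a; apply/measurable_EFinP/measurable_funM.
  - by move=> a w _; rewrite lee_fin mulr_ge0.
  rewrite -sumEFin; apply: eq_bigr => a _; under eq_integral do rewrite EFinM.
  rewrite ge0_integralZl//; last 2 first.
  - exact/measurable_EFinP.
  - by rewrite lee_fin.
  rewrite [X in (_ * X)%E](_ : _ = \int[P]_w (\1_(X i @^-1` B a) w)%:E)%E//.
  by rewrite integral_indic// setIT EFinM -pE.
(* Each [f] selects one value of [h] per index; the product of the selected indicators is the
   indicator of the intersection. *)
transitivity (\int[P]_w (\sum_(f : {ffun I -> 'I_m})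
   ((\prod_i s`_(f i)) * \1_(\bigcap_(i in [set` [set: I]%SET])
      (X i @^-1` B (f i))) w)%:E))%E.
  apply: eq_integral => w _; rewrite sumEFin; congr (_%:E).
  under eq_bigr do rewrite hE.
  rewrite bigA_distr_bigA; apply: eq_bigr => f _; rewrite big_split/=.
  congr (_ * _); rewrite indicE.
  have [wB|wB] := boolP (w \in _).
    rewrite big1// => i _; rewrite indicE mem_set//.
    by move: wB; rewrite inE => /(_ i); apply; rewrite /= inE.
  have /existsP[i iB] : [exists i, X i w \notin B (f i)].
    apply: contraNT wB => /existsPn H; rewrite inE => i _ /=.
    by have := H i; rewrite negbK inE.
  by rewrite (bigD1 i)//= indicE (negbTE iB) mul0r.
have mcap (f : {ffun I -> 'I_m}) : measurable
    (\bigcap_(i in [set` [set: I]%SET]) (X i @^-1` B (f i))).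
  by apply: fin_bigcap_measurable => // i _.
rewrite ge0_integral_sum//; last 2 first.
- by move=> f; apply/measurable_EFinP/measurable_funM.
- by move=> f w _; rewrite lee_fin mulr_ge0// prodr_ge0.
rewrite (eq_bigr _ (fun i _ => intE i)) prodEFin bigA_distr_bigA -sumEFin.
apply: eq_bigr => f _; under eq_integral do rewrite EFinM.
rewrite ge0_integralZl//; last 2 first.
- by apply/measurable_EFinP; exact: measurable_indic.
- by rewrite lee_fin prodr_ge0.
have capE : P (\bigcap_(i in [set` [set: I]%SET]) (X i @^-1` B (f i))) =
    (\prod_i p i (f i))%:E.
  rewrite (indX [set: I]%SET (fun i => B (f i)))// -prodEFin.
  by apply: eq_big => [i|i _]; rewrite ?inE.
by rewrite integral_indic// setIT big_split/= EFinM -capE.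
Qed.

Lemma lee_prod (R : realType) (I : finType) (F G : I -> \bar R) :
  (forall i, 0 <= F i)%E -> (forall i, F i <= G i)%E ->
  (\prod_i F i <= \prod_i G i)%E.
Proof.
move=> F0 FG.
suff: (0 <= \prod_i F i)%E /\ (\prod_i F i <= \prod_i G i)%E by case.
elim/big_ind2 : _ => [|x1 x2 y1 y2 [x0 x12] [y0 y12]|i _].
- by rewrite lee01 lexx.
- by rewrite mule_ge0// lee_pmul.
- by rewrite F0 FG.
Qed.

(** Approximate [f] from below by simple functions [h k]. Markov's inequality only needs this upper
    bound, so monotone convergence is applied on the left, while [h k <= f] suffices on the
    right. *)
Lemma integral_prod_le (R : realType) (d : measure_display)
    (T : measurableType d) (P : probability T R) (I : finType)
    (X : I -> {RV P >-> R}) (f : R -> R) :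
  mutually_independent X -> measurable_fun [set: R] f -> (forall x, 0 <= f x) ->
  (\int[P]_w (\prod_i f (X i w))%:E <= \prod_i \int[P]_w (f (X i w))%:E)%E.
Proof.
move=> indX mf f0.
have mfE : measurable_fun [set: R] (EFin \o f) by exact/measurable_EFinP.
have fE0 x : [set: R] x -> (0 <= (EFin \o f) x)%E by rewrite lee_fin.
pose h := nnsfun_approx measurableT mfE.
have hcvg x : h k x @[k --> \oo] --> f x.
  by have /fine_cvgP[_] := cvg_nnsfun_approx measurableT mfE fE0 (x := x) Logic.I.
have hnd x : nondecreasing_seq (fun k => h k x).
  by move=> a b ab; exact/lefP/nd_nnsfun_approx.
have hlef k x : h k x <= f x.
  rewrite -(cvg_lim _ (hcvg x))//; apply: nondecreasing_cvgn_le => //.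
  by apply/cvg_ex; exists (f x).
have mhX k i : measurable_fun [set: T] (fun w => h k (X i w)).
  by apply: measurableT_comp.
rewrite [leLHS](_ : _ =
    \int[P]_w limn (fun k => (\prod_i h k (X i w))%:E))%E; last first.
  apply: eq_integral => w _; apply/esym/cvg_lim => //; apply: cvg_EFin.
    by apply: nearW.
  by apply: cvg_big => //; exact: mul_continuous.
rewrite monotone_convergence//; last 3 first.
- by move=> k; apply/measurable_EFinP; apply: measurable_prod.
- by move=> k w _; rewrite lee_fin prodr_ge0.
- by move=> w _ a b ab; rewrite lee_fin ler_prod// => i _; rewrite fun_ge0/= hnd.
apply: lime_le.
  apply: ereal_nondecreasing_is_cvgn => a b ab; apply: ge0_le_integral => //.
  - by move=> w _; rewrite lee_fin prodr_ge0.
  - by apply/measurable_EFinP; apply: measurable_prod.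
  - by apply/measurable_EFinP; apply: measurable_prod.
  - by move=> w _; rewrite lee_fin ler_prod// => i _; rewrite fun_ge0/= hnd.
apply: nearW => k; rewrite integral_prod_nnsfun//; apply: lee_prod => i.
  by apply: integral_ge0 => w _; rewrite lee_fin.
apply: ge0_le_integral => //.
- by move=> w _; rewrite lee_fin.
- exact/measurable_EFinP.
- by apply/measurable_EFinP; apply: measurableT_comp.
- by move=> w _; rewrite lee_fin.
Qed.

(** * Chernoff bound for chi-square sums *)

(** Markov's inequality for the exponential of the right-hand side, each factor having expectation
    [c^(-1/2)]. The upper tail is the case [c < 1], the lower tail the case [c > 1]. *)
Lemma gaussian_chernoff (R : realType) (d : measure_display)
    (T : measurableType d) (P : probability T R) (I : finType)
    (X : I -> {RV P >-> R}) (s c b : R) :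
  mutually_independent X ->
  (forall i A, measurable A -> distribution P (X i) A = normal_prob 0 s A) ->
  0 < s -> 0 < c ->
  (P [set w | (b <= (1 - c) * \sum_i (X i w ^+ 2 / (s ^+ 2 *+ 2)))%R] <=
   (((Num.sqrt c)^-1 ^+ #|I|) * expR (- b))%:E)%E.
Proof.
move=> indX lawX s0 c0.
pose f x := expR ((1 - c) * (x ^+ 2 / (s ^+ 2 *+ 2))).
have f0 x : 0 <= f x by exact: expR_ge0.
have mf : measurable_fun [set: R] f.
  apply: measurableT_comp => //; apply: measurable_funM => //.
  exact: measurable_funM.
have prodf w : \prod_i f (X i w) =
    expR ((1 - c) * \sum_i (X i w ^+ 2 / (s ^+ 2 *+ 2))).
  by rewrite mulr_sumr expR_sum.
have mprod : measurable_fun [set: T] (fun w => (\prod_i f (X i w))%:E).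
  apply/measurable_EFinP; apply: measurable_prod => i _.
  exact: measurableT_comp.
have := @le_integral_abse _ _ _ P _ measurableT _ _ mprod (expR_gt0 b).
rewrite setTI [X in (_ * P X <= _)%E](_ : _ =
    [set w | (b <= (1 - c) * \sum_i (X i w ^+ 2 / (s ^+ 2 *+ 2)))%R]);
    last first.
  apply/seteqP; split => w /=; rewrite lee_fin ger0_norm ?prodr_ge0//;
    by rewrite prodf ler_expR.
under eq_integral do rewrite gee0_abs ?lee_fin ?prodr_ge0//.
move=> /le_trans/(_ (@integral_prod_le _ _ _ P _ X f indX mf f0)).
rewrite [X in (_ <= X)%E](_ : _ = ((Num.sqrt c)^-1 ^+ #|I|)%:E); last first.
  rewrite -(prodr_const _ _) -prodEFin; apply: eq_bigr => i _.
  rewrite -(@integral_normal_prob_expR_sqr R s c)//.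
  rewrite -(@ge0_integral_comp_normal _ _ _ P (X i) 0 s (EFin \o f))//.
    exact: lawX.
  exact/measurable_EFinP.
by rewrite expRN EFinM lee_pdivlMr ?expR_gt0// muleC.
Qed.

(** * Probability that some column is short *)

Lemma prob_avoid_all (R : realType) (d : measure_display)
    (T : measurableType d) (P : probability T R) (J : finType)
    (E : J -> set T) (r : R) :
  (forall j, measurable (E j)) ->
  (forall L : {set J}, P (\bigcap_(j in [set` L]) E j) = (r ^+ #|L|)%:E) ->
  P (\bigcap_(j in [set: J]) ~` E j) = ((1 - r) ^+ #|J|)%:E.
Proof.
move=> mE PE.
(* Generalised to mixed intersections for an induction on [#|K|]: an index [k] is removed from [K]
   through [P (F \ E k) = P F - P (F & E k)], where the last term has [k] moved to [L]. *)
suff H (m : nat) (K L : {set J}) : #|K| = m -> (forall j, j \in K -> j \notin L) ->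
    P (\bigcap_(j in [set` K]) ~` E j `&` \bigcap_(j in [set` L]) E j) =
    ((1 - r) ^+ #|K| * r ^+ #|L|)%:E.
  have := H _ [set: J]%SET finset.set0 erefl; rewrite cards0 expr0 mulr1 cardsT.
  move=> <-; last by move=> j _; rewrite inE.
  congr (P _).
  apply/seteqP; split => [w wE|w [wE _]]; last first.
    by move=> j _; apply: wE; rewrite /= inE.
  by split=> j /=; rewrite inE// => _; exact: wE.
elim: m K L => [|m IH] K L.
  move=> /eqP; rewrite cards_eq0 => /eqP -> _.
  rewrite cards0 expr0 mul1r -PE; congr (P _).
  apply/seteqP; split => [w []//|w wE]; split => // j /=.
  by rewrite inE.
move=> Km KL.
have /card_gt0P[k kK] : (0 < #|K|)%N by rewrite Km.
have Kk : #|(K :\ k)%SET| = m.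
  by apply/eqP; rewrite -eqSS -Km (cardsD1 k K) kK.
have kL : k \notin L by exact: KL.
have KkL j : j \in (K :\ k)%SET -> j \notin L.
  by rewrite !inE => /andP[_]; exact: KL.
have KkLk j : j \in (K :\ k)%SET -> j \notin (k |: L)%SET.
  by rewrite !inE negb_or => /andP[-> /KL].
set F := \bigcap_(j in [set` (K :\ k)%SET]) ~` E j `&`
  \bigcap_(j in [set` L]) E j.
have mF : measurable F.
  apply: measurableI; apply: fin_bigcap_measurable => // j _.
  exact: measurableC.
have -> : \bigcap_(j in [set` K]) ~` E j `&` \bigcap_(j in [set` L]) E j =
    F `\` (F `&` E k).
  apply/seteqP; split => [w [wK wL]|w [[wK wL] nE]]; last first.
    split=> // j /= jK; have [->|jk] := eqVneq j k.
      by move=> Ek; apply: nE.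
    by apply: wK; rewrite /= !inE jk.
  split; last by case=> _; exact: wK.
  by split=> // j /=; rewrite !inE => /andP[_ jK]; exact: wK.
have FE : F `&` E k = \bigcap_(j in [set` (K :\ k)%SET]) ~` E j `&`
    \bigcap_(j in [set` (k |: L)%SET]) E j.
  apply/seteqP; split => [w [[wK wL] wk]|w [wK wL]].
    by split=> // j /=; rewrite !inE => /orP[/eqP ->|] //; exact: wL.
  split; last by apply: wL; rewrite /= !inE eqxx.
  by split=> // j /= jL; apply: wL; rewrite /= !inE jL orbT.
have -> : P (F `\` (F `&` E k)) = (P F - P (F `&` E k))%E.
  rewrite measureD//; last 2 first.
  - exact: measurableI.
  - by rewrite (le_lt_trans (probability_le1 P mF))// ltry.
  by rewrite (setIidr (@subIsetl _ F (E k))).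
rewrite FE (IH _ _ Kk KkLk) (IH _ _ Kk KkL) -EFinB.
by rewrite cardsU1 kL Kk Km; congr (_%:E); rewrite add1n !exprS; ring.
Qed.

Lemma prob_no_small_column (R : realType) (d : measure_display)
    (T : measurableType d) (P : probability T R) (t n : nat)
    (G : 'I_t * 'I_n -> {RV P >-> R}) (A : set R) (p : R) :
  mutually_independent G -> measurable A ->
  (forall ij, P (G ij @^-1` A) = p%:E) ->
  P (\bigcap_(j in [set: 'I_n])
       ~` (\bigcap_(i in [set: 'I_t]) (G (i, j) @^-1` A))) =
  ((1 - p ^+ t) ^+ n)%:E.
Proof.
move=> indG mA GA.
have mG ij : measurable (G ij @^-1` A).
  by rewrite -[_ @^-1` _]setTI; exact: measurable_funP.
rewrite (@prob_avoid_all _ _ _ P _ _ (p ^+ t)) ?card_ord//.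
  by move=> j; apply: fin_bigcap_measurable.
(* All columns of [L] are short when every entry of the block of all rows by [L] lies in [A], hence
   [t * #|L|] factors [p]. *)
move=> L; have := indG (finset.setX [set: 'I_t]%SET L) (fun=> A) (fun=> mA).
rewrite (eq_bigr (fun=> p%:E)); last by move=> ij _; rewrite GA.
rewrite prodEFin prodr_const cardsX cardsT card_ord exprM => <-; congr (P _).
apply/seteqP; split => [w wA [i j] /=|w wA j /= jL i _].
  by rewrite !inE/= => jL; apply: wA.
by apply: (wA (i, j)); rewrite /= !inE.
Qed.

(* The length [2 e s] of the interval [[-es, es]] times the density of
   [N(0, s^2)] at its endpoints, in which [s] cancels. *)
Definition small_ball_lb {R : realType} (e : R) : R :=
  normal_peak 1 * expR (- (e ^+ 2 / 2)) * (2 * e).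

Lemma small_ball_lb_gt0 (R : realType) (e : R) : 0 < e -> 0 < small_ball_lb e.
Proof.
by move=> e0; rewrite !mulr_gt0 ?expR_gt0// normal_peak_gt0// oner_eq0.
Qed.

(** The density on the interval is at least its value at the endpoints. As the bound is free of [s],
    a single constant will serve the standard deviations [t^(-1/2)] for all [t]. *)
Lemma normal_prob_small_ball (R : realType) (s e : R) : 0 < s -> 0 < e ->
  ((small_ball_lb e)%:E <= normal_prob 0 s `[(- (e * s))%R, (e * s)%R]%classic)%E.
Proof.
move=> s0 e0; have sn0 : s != 0 by rewrite gt_eqF.
have es0 : 0 < e * s by rewrite mulr_gt0.
apply: (@le_trans _ _ (\int[lebesgue_measure]_(x in `[(- (e * s))%R, (e * s)%R]%classic)
    (cst (normal_peak s * expR (- (e ^+ 2 / 2)))%R%:E x))%E).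
  rewrite integral_cst//= lebesgue_measure_itv/= lte_fin gtrN// -EFinB -EFinM.
  rewrite lee_fin le_eqVlt; apply/orP; left; apply/eqP.
  have -> : normal_peak s = normal_peak 1 / s.
    rewrite /normal_peak expr1n mul1r -mulrnAr sqrtrM ?sqr_ge0//.
    by rewrite sqrtr_sqr gtr0_norm// invfM mulrC.
  by rewrite /small_ball_lb; field.
rewrite /normal_prob; apply: ge0_le_integral => //=.
- by move=> x _; rewrite lee_fin mulr_ge0 ?normal_peak_ge0 ?expR_ge0.
- by apply/measurable_EFinP/measurable_funTS; exact: measurable_normal_pdf.
- move=> x; rewrite in_itv/= => xe; rewrite lee_fin normal_pdfE//.
  rewrite ler_wpM2l ?normal_peak_ge0// /normal_fun subr0 ler_expR mulNr lerN2.
  rewrite ler_pdivrMr ?pmulrn_lgt0 ?exprn_gt0//.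
  have -> : e ^+ 2 / 2 * (s ^+ 2 *+ 2) = (e * s) ^+ 2 by field.
  by rewrite -ler_sqrt ?sqr_ge0// !sqrtr_sqr (gtr0_norm es0) ler_norml.
Qed.

(** * Deterministic bounds on medoid costs *)

Lemma norm2_sqr (R : realType) (d : nat) (v : 'cV[R]_d) :
  norm2 v ^+ 2 = \sum_(i < d) v i ord0 ^+ 2.
Proof. by rewrite sqr_sqrtr// sumr_ge0// => i _; exact: sqr_ge0. Qed.

Lemma fsum_std_basis (R : realType) (n : nat) (F : 'cV[R]_n -> R) :
  \sum_(x \in @std_basis R n) F x = \sum_(j < n) F (delta_mx j ord0).
Proof.
have inj : {in [set: 'I_n] &,
    injective (fun j : 'I_n => delta_mx j ord0 : 'cV[R]_n)}.
  move=> i j _ _ /matrixP/(_ i ord0); rewrite !mxE !eqxx/=.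
  by have [//|_ /eqP] := eqVneq i j; rewrite oner_eq0.
rewrite /std_basis fsbig_image// [RHS]fsbig_seq ?index_enum_uniq//.
apply: eq_fsbigl; apply/seteqP; split=> // j _ /=.
by rewrite mem_index_enum.
Qed.

(** Centers are given by their index, so that coinciding images need no separate treatment. *)
Definition medoid_cost {R : realType} {n t : nat} (g : 'I_n -> 'cV[R]_t)
  (c : 'I_n) : R := \sum_(j < n) norm2 (g j - g c) ^+ 2.

Lemma medoid_cost_ge0 (R : realType) (n t : nat) (g : 'I_n -> 'cV[R]_t)
  (c : 'I_n) : 0 <= medoid_cost g c.
Proof. by rewrite sumr_ge0// => j _; exact: sqr_ge0. Qed.

Lemma min_cost_attained (R : realType) (n t : nat)
    (f : 'cV[R]_n -> 'cV[R]_t) (c0 : 'I_n)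
    (g := fun j : 'I_n => f (delta_mx j ord0)) :
  exists2 c, min_cost (@std_basis R n) f (f @` @std_basis R n) =
             medoid_cost g c
           & forall c', medoid_cost g c <= medoid_cost g c'.
Proof.
case: (Order.TotalTheory.arg_minP (medoid_cost g) (i0 := c0) (P := predT)) =>
  //.
move=> c _ cmin; exists c => [|c']; last exact: cmin.
have gc : [set \sum_(x \in @std_basis R n) norm2 (f x - y) ^+ 2 |
    y in f @` @std_basis R n] (medoid_cost g c).
  exists (g c); first by exists (delta_mx c ord0) => //; exists c.
  by rewrite fsum_std_basis.
have lb : lbound [set \sum_(x \in @std_basis R n) norm2 (f x - y) ^+ 2 |
    y in f @` @std_basis R n] (medoid_cost g c).
  by move=> _ [_ [_ [c' _ <-] <-] <-]; rewrite fsum_std_basis; exact: cmin.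
rewrite /min_cost; apply/eqP; rewrite eq_le; apply/andP; split.
  by apply: ge_inf => //; exists (medoid_cost g c).
by apply: lb_le_inf => //; exists (medoid_cost g c).
Qed.

(** There are [n.+1] points: the center contributes 0, and each of the [n] others is at squared
    distance 2 from it. *)
Lemma min_cost_id (R : realType) (n : nat) :
  min_cost (@std_basis R n.+1) id (@std_basis R n.+1) = (2 * n)%:R.
Proof.
have [c] := @min_cost_attained R n.+1 n.+1 id ord0.
rewrite image_id => -> _.
have sum1 (j : 'I_n.+1) : \sum_(i < n.+1) (i == j)%:R = 1 :> R.
  by rewrite (bigD1 j)//= eqxx big1 ?addr0// => i /negbTE ->.
have costE (j : 'I_n.+1) :
    norm2 (delta_mx j ord0 - delta_mx c ord0 : 'cV[R]_n.+1) ^+ 2 =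
    2 - 2 * (j == c)%:R.
  rewrite norm2_sqr.
  have [->|jc] := eqVneq j c.
    rewrite big1; first by rewrite mulr1 subrr.
    by move=> i _; rewrite !mxE subrr expr0n.
  rewrite mulr0 subr0 (eq_bigr (fun i => (i == j)%:R + (i == c)%:R)).
    by rewrite big_split/= !sum1.
  move=> i _; rewrite !mxE eqxx !andbT.
  have [->|ij] := eqVneq i j; first by rewrite (negbTE jc) subr0 addr0 expr1n.
  by case: (i == c); rewrite ?subr0 ?add0r ?sub0r ?sqrrN ?expr1n ?expr0n.
rewrite /medoid_cost (eq_bigr _ (fun j _ => costE j)) sumrB -mulr_sumr sum1.
by rewrite sumr_const card_ord mulr1 -mulrnA mulnS natrD addrAC subrr add0r.
Qed.

(* AM-GM: [(a - b)^2 <= (1 + s) a^2 + (1 + 1/s) b^2]. *)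
Lemma medoid_cost_le (R : realType) (n t : nat) (g : 'I_n -> 'cV[R]_t)
    (c : 'I_n) (s : R) : 0 < s -> norm2 (g c) ^+ 2 <= s ^+ 2 ->
  medoid_cost g c <=
  (1 + s) * (\sum_(j < n) norm2 (g j) ^+ 2) + n%:R * (s + s ^+ 2).
Proof.
move=> s0 gc; rewrite mulr_sumr -[in n%:R](card_ord n) mulr_natl.
rewrite -sumr_const -big_split/=; apply: ler_sum => j _.
apply: (@le_trans _ _ ((1 + s) * norm2 (g j) ^+ 2 +
    (1 + s^-1) * norm2 (g c) ^+ 2)); last first.
  rewrite lerD2l; apply: (le_trans (ler_wpM2l _ gc)).
    by rewrite addr_ge0// invr_ge0 ltW.
  by rewrite le_eqVlt; apply/orP; left; apply/eqP; field; rewrite gt_eqF.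
rewrite !norm2_sqr !mulr_sumr -big_split/=; apply: ler_sum => i _; rewrite !mxE.
set a := g j i ord0; set b := g c i ord0.
(* The slack in the AM-GM inequality is an explicit square. *)
have -> : (1 + s) * a ^+ 2 + (1 + s^-1) * b ^+ 2 =
    (a - b) ^+ 2 + s^-1 * (s * a + b) ^+ 2 by field; rewrite gt_eqF.
by rewrite lerDl mulr_ge0 ?invr_ge0 ?sqr_ge0// ltW.
Qed.

(** A zero cost would make all the [g j] equal, in particular to [g c0], turning the assumed strict
    inequality into an equality. *)
Lemma medoid_cost_gt0 (R : realType) (n t : nat) (g : 'I_n -> 'cV[R]_t)
    (c c0 : 'I_n) : n%:R * norm2 (g c0) ^+ 2 < \sum_(j < n) norm2 (g j) ^+ 2 ->
  0 < medoid_cost g c.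
Proof.
move=> lt_c0; rewrite lt0r medoid_cost_ge0 andbT; apply: contraTneq lt_c0 => D0.
have gE j : g j = g c.
  have := D0; rewrite /medoid_cost => /eqP; rewrite psumr_eq0; last first.
    by move=> k _; exact: sqr_ge0.
  move=> /allP/(_ j); rewrite mem_index_enum => /(_ isT) /=.
  rewrite norm2_sqr psumr_eq0; last by move=> k _; exact: sqr_ge0.
  move=> /allP gj; apply/matrixP => i k; rewrite ord1.
  have := gj i; rewrite mem_index_enum => /(_ isT) /=.
  by rewrite sqrf_eq0 !mxE subr_eq0 => /eqP.
rewrite -leNgt (eq_bigr (fun=> norm2 (g c) ^+ 2)); last by move=> j _; rewrite gE.
by rewrite sumr_const card_ord mulr_natl gE.
Qed.

(** Since division by 0 yields 0 and [0 < r], the ratio bound forces a positive denominator. The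
    right-hand side, a finite union and a finite intersection over centers, is the form used for
    measurability. *)
Lemma medoid_ratioP (R : realType) (n t : nat)
    (f : 'cV[R]_n.+1 -> 'cV[R]_t) (r : R)
    (g := fun j : 'I_n.+1 => f (delta_mx j ord0)) : 0 < r ->
  r <= min_cost (@std_basis R n.+1) id (@std_basis R n.+1) /
       min_cost (@std_basis R n.+1) f (f @` @std_basis R n.+1) <->
  (exists c, r * medoid_cost g c <= (2 * n)%:R) /\
  (forall c, 0 < medoid_cost g c).
Proof.
move=> r0; rewrite min_cost_id.
have [c -> cmin] := @min_cost_attained _ _ _ f ord0; split.
  move=> rc; have c0 : 0 < medoid_cost g c.
    rewrite lt0r medoid_cost_ge0 andbT; apply: contraTneq rc => ->.
    by rewrite invr0 mulr0 -ltNge.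
  split=> [|c']; last exact: lt_le_trans (cmin c').
  by exists c; rewrite -ler_pdivlMr.
move=> [[c' rc'] Dgt0]; rewrite ler_pdivlMr; last exact: Dgt0.
by apply: le_trans rc'; rewrite ler_pM2l.
Qed.

(** * Measurability and asymptotic tools *)

Lemma measurable_cst_le (R : realType) (d : measure_display)
    (T : measurableType d) (f : T -> R) (x : R) :
  measurable_fun [set: T] f -> measurable [set w | x <= f w].
Proof.
move=> mf; rewrite -[X in measurable X]setTI.
rewrite (_ : [set w | x <= f w] = f @^-1` `[x, +oo[%classic).
  exact: mf.
by apply/seteqP; split => w /=; rewrite in_itv/= andbT.
Qed.

(** Written as [exp (ln n + t ln q)], the product is at least [exp (ln n / 2)] once
    [t |ln q| <= ln n / 2]. *)
Lemma near_le_mul_expr (R : realType) (t : nat -> nat) (q M : R) : 0 < q ->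
  (fun n : nat => (t n)%:R : R) =o_\oo (fun n : nat => ln (n%:R : R)) ->
  \forall n \near \oo, M <= n%:R * q ^+ t n.
Proof.
move=> q0 /eqoP tlog.
(* Adding 1 to [|ln q|] keeps the constant well defined when [q = 1]. *)
have k0 : 0 < (2 * (1 + `|ln q|))^-1 :> R.
  by rewrite invr_gt0 mulr_gt0// ltr_wpDr.
near=> n.
have n0 : (0 < n)%N by near: n; exact: nbhs_infty_gt.
have n1 : 1 <= n%:R :> R by rewrite ler1n.
have n0R : 0 < n%:R :> R by rewrite ltr0n.
have tn : (t n)%:R <= (2 * (1 + `|ln q|))^-1 * ln (n%:R : R).
  rewrite -[X in X <= _]ger0_norm// -[X in _ <= _ * X]ger0_norm ?ln_ge0//.
  by near: n; exact: tlog.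
have nM : expR (2 * `|M|) <= n%:R.
  near: n; exact: nbhs_infty_ger.
have lnM : `|M| <= ln (n%:R : R) / 2.
  by rewrite ler_pdivlMr// mulrC -[leLHS]expRK ler_ln ?posrE ?expR_gt0//.
have -> : n%:R * q ^+ t n = expR (ln (n%:R : R) + (t n)%:R * ln q).
  by rewrite expRD lnK ?posrE// expRM_natl lnK.
apply: (@le_trans _ _ (expR (ln (n%:R : R) / 2))).
  apply: (le_trans (ler_norm M)); apply: (le_trans lnM).
  by apply: le_trans (expR_ge1Dx _); rewrite lerDr.
rewrite ler_expR.
have tq : (t n)%:R * `|ln q| <= ln (n%:R : R) / 2.
  have a0 : 0 < 1 + `|ln q| by rewrite ltr_wpDr.
  apply: (@le_trans _ _ ((t n)%:R * (1 + `|ln q|))).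
    by rewrite ler_wpM2l// lerDr.
  apply: (le_trans (ler_wpM2r (ltW a0) tn)).
  by rewrite le_eqVlt; apply/orP; left; apply/eqP; field; rewrite gt_eqF.
have : - ((t n)%:R * `|ln q|) <= (t n)%:R * ln q.
  by rewrite -mulrN ler_wpM2l// lerNl -normrN ler_norm.
lra.
Unshelve. all: by end_near. Qed.

(* [eps n] is [1/(k+1)] for the largest [k <= n] with [Q n (1/(k+1))], so that
   [Q n] need not be monotone. *)
Lemma diagonal_rate (R : realType) (Q : nat -> R -> Prop) :
  (forall n, Q n 2) ->
  (forall e, 0 < e <= 1 -> \forall n \near \oo, Q n e) ->
  exists2 eps : nat -> R, eps n @[n --> \oo] --> 0 & forall n, Q n (eps n).
Proof.
move=> Q2 Qe.
(* When no [k] qualifies, the fallback is 2, where [Q n] always holds. *)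
pose eps n : R := if [pick k : 'I_n.+1 | `[< Q n k.+1%:R^-1 >]] is Some k0 then
    ([arg max_(k > k0 | `[< Q n k.+1%:R^-1 >]) (k : nat)] : 'I_n.+1).+1%:R^-1
  else 2.
exists eps; last first.
  move=> n; rewrite /eps; case: pickP => // k0 Qk0.
  by case: arg_maxnP => // k /asboolP.
apply/cvgrPdist_le => e e0; near \oo => k.
have ke : k.+1%:R^-1 <= e :> R.
  by apply: ltW; near: k; exact: near_infty_natSinv_lt (PosNum e0).
have k1 : 0 < (k.+1%:R^-1 : R) <= 1.
  by rewrite invr_gt0 ltr0n/= invf_le1 ?ltr0n// ler1n.
near=> n.
have kn : (k < n.+1)%N by near: n; exact: nbhs_infty_ge.
have Qk : Q n k.+1%:R^-1 by near: n; exact: Qe.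
rewrite sub0r normrN /eps; case: pickP => [k0 Qk0|/(_ (Ordinal kn))]; last first.
  by move=> /asboolP.
case: arg_maxnP => // j _ jmax.
have kj : (k <= j)%N by apply: (jmax (Ordinal kn)); apply/asboolP.
rewrite ger0_norm ?invr_ge0//; apply: le_trans ke.
by rewrite lef_pV2 ?posrE ?ltr0n// ler_nat.
Unshelve. all: by end_near. Qed.

Lemma measurable_medoid_cost (R : realType) (d : measure_display)
    (T : measurableType d) (n t : nat) (g : T -> 'I_n -> 'cV[R]_t) (c : 'I_n) :
  (forall i j, measurable_fun [set: T] (fun w => g w j i ord0)) ->
  measurable_fun [set: T] (fun w => medoid_cost (g w) c).
Proof.
move=> mg; rewrite /medoid_cost; apply: measurable_sum => j.
under eq_fun do rewrite norm2_sqr.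
apply: measurable_sum => i; apply: measurable_funX.
under eq_fun do rewrite !mxE.
exact: measurable_funB.
Qed.

(** * The ratio bound for fixed [s] and finite [n] *)

(** The three subtracted terms bound the probabilities that [S] is too large, that [S] is too small,
    and that no column is short. *)
Lemma jl_ratio_prob_ge (R : realType) (d : measure_display)
    (T : measurableType d) (P : probability T R) (n t : nat)
    (Pi : T -> 'cV[R]_n.+1 -> 'cV[R]_t) (s : R) :
  jl_distributed P Pi -> (0 < t)%N -> 0 < s <= 10^-1 -> 1 <= s * n.+1%:R ->
  ((1 - ((Num.sqrt (1 + s) * expR (- (s / 2))) ^+ (t * n.+1) +
         (4 / 5) ^+ (t * n.+1) +
         expR (- (n.+1%:R * small_ball_lb s ^+ t))))%:E <=
   P [set w | (2 - 10 * s <=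
      min_cost (@std_basis R n.+1) id (@std_basis R n.+1) /
      min_cost (@std_basis R n.+1) (Pi w) (Pi w @` @std_basis R n.+1))%R])%E.
Proof.
move=> [G [indG lawG PiE]] t0 /andP[s0 s10] sn.
have r0 : 0 < 2 - 10 * s by lra.
have tR0 : 0 < t%:R :> R by rewrite ltr0n.
have nR0 : 0 < n.+1%:R :> R by rewrite ltr0n.
pose sigma : R := Num.sqrt (t%:R^-1).
have sigma0 : 0 < sigma by rewrite sqrtr_gt0 invr_gt0.
have sigma2 : sigma ^+ 2 = t%:R^-1 by rewrite sqr_sqrtr// invr_ge0.
pose g w (j : 'I_n.+1) := Pi w (delta_mx j ord0).
have gE w i j : g w j i ord0 = G (i, j) w by rewrite /g PiE -colE !mxE.
pose D c w := medoid_cost (g w) c.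
have mD c : measurable_fun [set: T] (D c).
  apply: measurable_medoid_cost => i j; under eq_fun do rewrite gE.
  exact: measurable_funPT.
pose S w := \sum_(j < n.+1) norm2 (g w j) ^+ 2.
have SE w : \sum_ij (G ij w ^+ 2 / (sigma ^+ 2 *+ 2)) = t%:R / 2 * S w.
  rewrite /S mulr_sumr (eq_bigr (fun j => \sum_(i < t)
      (G (i, j) w ^+ 2 / (sigma ^+ 2 *+ 2)))); last first.
    move=> j _; rewrite norm2_sqr mulr_sumr; apply: eq_bigr => i _.
    by rewrite gE sigma2; field; rewrite gt_eqF.
  rewrite exchange_big/= pair_bigA/=; apply: eq_bigr => -[i j] _ //.
pose X c w := (1 - c) * \sum_ij (G ij w ^+ 2 / (sigma ^+ 2 *+ 2)).
have mX c b : measurable [set w | b <= X c w].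
  apply: measurable_cst_le; apply: measurable_funM => //.
  apply: measurable_sum => ij; apply: measurable_funM => //.
  exact: measurable_funX.
(* For a threshold [S = a n.+1] the optimal Chernoff parameter is [c = 1/a]: here [a = 1 + s] with
   bound [b1], and [a = 1/4] with [c = 4] and bound [b2]. *)
pose c1 := (1 + s)^-1; pose b1 := s * (t%:R * n.+1%:R) / 2.
pose b2 := - (3 / 8 * (t%:R * n.+1%:R)) : R.
have cardI : #|{: 'I_t * 'I_n.+1}| = (t * n.+1)%N by rewrite card_prod !card_ord.
have P1 : (P [set w | (b1 <= X c1 w)%R] <=
    ((Num.sqrt (1 + s) * expR (- (s / 2))) ^+ (t * n.+1))%:E)%E.
  have c10 : 0 < c1 by rewrite invr_gt0; lra.
  apply: (le_trans (@gaussian_chernoff _ _ _ P _ G sigma c1 b1 indG lawG sigma0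
    c10)).
  rewrite lee_fin cardI exprMn -expRM_natl natrM le_eqVlt; apply/orP; left.
  apply/eqP; congr (_ * expR _).
    by rewrite sqrtrV ?invrK//; lra.
  by rewrite /b1; field.
have P2 : (P [set w | (b2 <= X 4 w)%R] <= ((4 / 5) ^+ (t * n.+1))%:E)%E.
  have c20 : 0 < 4 :> R by [].
  apply: (le_trans (@gaussian_chernoff _ _ _ P _ G sigma 4 b2 indG lawG sigma0
    c20)).
  have -> : Num.sqrt (4 : R) = 2.
    by rewrite (_ : 4 = 2 ^+ 2) ?sqrtr_sqr ?ger0_norm//; ring.
  have -> : - b2 = (t * n.+1)%:R * (3 / 8) by rewrite /b2 opprK natrM mulrC.
  rewrite lee_fin cardI expRM_natl -exprMn lerXn2r ?nnegrE ?mulr_ge0 ?expR_ge0//.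
  (* From [exp (-3/8) >= 1 - 3/8]; each factor [exp (3/8) / 2] is then at most [4/5]. *)
  have : expR (3 / 8 : R) <= 8 / 5.
    have := expR_ge1Dx (- (3 / 8) : R); rewrite expRN => H.
    rewrite -[leLHS]invrK -[leRHS]invrK lef_pV2 ?posrE ?invr_gt0 ?expR_gt0//.
    by lra.
  lra.
(* If all [t] entries of a column lie in this interval, its squared norm is at most
   [t (s sigma)^2 = s^2]. *)
pose A := `[- (s * sigma), s * sigma]%classic : set R.
pose p := fine (normal_prob 0 sigma A).
have mA : measurable A by exact: measurable_itv.
have pE : normal_prob 0 sigma A = p%:E.
  by rewrite fineK//; exact: (fin_num_measure (normal_prob 0 sigma)).
have qp : small_ball_lb s <= p.
  by rewrite -lee_fin -pE; exact: normal_prob_small_ball.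
have p1 : p <= 1 by rewrite -lee_fin -pE; exact: probability_le1.
have q0 := small_ball_lb_gt0 R s s0.
have p0 : 0 <= p by apply: le_trans qp; exact: ltW.
pose B3 := \bigcap_(j in [set: 'I_n.+1])
       ~` (\bigcap_(i in [set: 'I_t]) (G (i, j) @^-1` A)).
have mB3 : measurable B3.
  apply: fin_bigcap_measurable => // j _; apply: measurableC.
  apply: fin_bigcap_measurable => // i _.
  by rewrite -[_ @^-1` _]setTI; exact: measurable_funP.
have P3 : (P B3 <= (expR (- (n.+1%:R * small_ball_lb s ^+ t)))%:E)%E.
  rewrite /B3 (@prob_no_small_column _ _ _ P _ _ G A p)//; last first.
    by move=> ij; rewrite -pE; exact: lawG.
  (* Uses [1 - p^t <= 1 - q^t <= exp (- q^t)], with [q] the small-ball bound. *)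
  rewrite lee_fin -mulrN expRM_natl.
  rewrite lerXn2r ?nnegrE ?expR_ge0 ?subr_ge0 ?exprn_ile1//.
  apply: le_trans (expR_ge1Dx _); rewrite lerD2l lerN2.
  by rewrite lerXn2r ?nnegrE// ltW.
rewrite [X in P X](_ : _ =
    [set w | exists c, (2 - 10 * s) * D c w <= (2 * n)%:R] `&`
    [set w | forall c, 0 < D c w]); last first.
  by apply/seteqP; split => w /=; rewrite medoid_ratioP.
set E := _ `&` _.
have mE : measurable E.
  apply: measurableI.
    rewrite (_ : mkset _ = \bigcup_(c in [set: 'I_n.+1])
        [set w | - (2 * n)%:R <= - ((2 - 10 * s) * D c w)]); last first.
      apply/seteqP; split => w /= => [[c]|[c _]] /=; rewrite ?lerN2 => H;
        exists c => //=.
      by rewrite lerN2.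
    apply: fin_bigcup_measurable => // c _; apply: measurable_cst_le.
    by apply: measurableT_comp => //; apply: measurable_funM.
  rewrite (_ : mkset _ = \bigcap_(c in [set: 'I_n.+1])
      ~` [set w | 0 <= - D c w]); last first.
    apply/seteqP; split => w /= => [H c _ /=|H c].
      by rewrite oppr_ge0; apply/negP; rewrite -ltNge.
    by have := H c Logic.I; rewrite /= oppr_ge0 => /negP; rewrite -ltNge.
  apply: fin_bigcap_measurable => // c _; apply: measurableC.
  by apply: measurable_cst_le; exact: measurableT_comp.
(* Outside the three bad events the argument is deterministic. *)
have sub : ~` E `<=` [set w | b1 <= X c1 w] `|` [set w | b2 <= X 4 w] `|` B3.
  move=> w nE; apply: contrapT => nB; apply: nE.
  have /negP : ~ (b1 <= X c1 w) by move=> H; apply: nB; left; left.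
  rewrite -ltNge /X SE => S1.
  have /negP : ~ (b2 <= X 4 w) by move=> H; apply: nB; left; right.
  rewrite -ltNge /X SE => S2.
  have [c0 c0A] : exists c0, forall i,
      G (i, c0) w \in `[- (s * sigma), s * sigma].
    apply: contrapT => nc0; apply: nB; right => j _ jA; apply: nc0.
    by exists j => i; exact: jA.
  have gc0 : norm2 (g w c0) ^+ 2 <= s ^+ 2.
    rewrite norm2_sqr; apply: (@le_trans _ _ (\sum_(i < t) (s * sigma) ^+ 2)).
      apply: ler_sum => i _; rewrite gE -ler_sqrt ?sqr_ge0// !sqrtr_sqr.
      rewrite [leRHS]gtr0_norm ?mulr_gt0// ler_norml.
      by have := c0A i; rewrite in_itv.
    rewrite sumr_const card_ord exprMn sigma2 -[leLHS]mulr_natr -mulrA mulVf ?mulr1//.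
    by rewrite gt_eqF.
  have S1' : S w <= (1 + s) * n.+1%:R.
    rewrite leNgt; apply/negP => H; move: S1; rewrite ltNge => /negP; apply.
    have -> : (1 - c1) * (t%:R / 2 * S w) = s * t%:R / 2 * (S w / (1 + s)).
      by rewrite /c1; field; rewrite gt_eqF//; lra.
    have -> : b1 = s * t%:R / 2 * n.+1%:R by rewrite /b1; ring.
    rewrite ler_wpM2l ?divr_ge0 ?mulr_ge0 ?ltW// ltr_pdivlMr; last by lra.
    by rewrite mulrC.
  have S2' : n.+1%:R / 4 < S w.
    rewrite ltNge; apply/negP => H; move: S2; rewrite ltNge => /negP; apply.
    rewrite /b2.
    have : t%:R * S w <= t%:R * (n.+1%:R / 4) by rewrite ler_wpM2l// ltW.
    lra.
  split; last first.
    move=> c; apply: (medoid_cost_gt0 R n.+1 t (g w) c c0).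
    (* Here [s <= 1/10] gives [s^2 <= 1/4]. *)
    apply: le_lt_trans S2'; rewrite ler_wpM2l// (le_trans gc0)//.
    nra.
  exists c0; have := medoid_cost_le R n.+1 t (g w) c0 s s0 gc0.
  rewrite -/(S w) -/(D c0 w) => Dle.
  have Dle' : D c0 w <= n.+1%:R * (1 + 3 * s + 2 * s ^+ 2).
    apply: (le_trans Dle).
    have : (1 + s) * S w <= (1 + s) * ((1 + s) * n.+1%:R).
      by rewrite ler_wpM2l//; lra.
    nra.
  have -> : (2 * n)%:R = 2 * n.+1%:R - 2 :> R.
    by rewrite natrM -[n.+1]addn1 natrD; ring.
  apply: (le_trans (ler_wpM2l (ltW r0) Dle')).
  (* The product expands to [2 - 4s - 26s^2 - 20s^3]. The margin [2 s n.+1] that is kept is at least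
     2, which pays for the center missing from [2 * n]. *)
  have : n.+1%:R * ((2 - 10 * s) * (1 + 3 * s + 2 * s ^+ 2)) <=
      n.+1%:R * (2 - 2 * s).
    by rewrite ler_wpM2l//; nra.
  lra.
have PC : (P (~` E) <= ((Num.sqrt (1 + s) * expR (- (s / 2))) ^+ (t * n.+1) +
         (4 / 5) ^+ (t * n.+1) +
         expR (- (n.+1%:R * small_ball_lb s ^+ t)))%:E)%E.
  have mU : measurable ([set w | b1 <= X c1 w] `|` [set w | b2 <= X 4 w]).
    exact: measurableU.
  apply: (@le_trans _ _
    (P ([set w | b1 <= X c1 w] `|` [set w | b2 <= X 4 w] `|` B3))).
    by apply: le_measure; rewrite ?inE//; [exact: measurableC|exact: measurableU].
  apply: (le_trans (measureU2 _ mU mB3)); rewrite EFinD; apply: leeD => //.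
  apply: (le_trans (measureU2 _ _ _)) => //; rewrite EFinD; exact: leeD.
rewrite -(setCK E) probability_setC; last exact: measurableC.
by rewrite EFinB leeB.
Qed.

(** * Passage to the limit *)

Lemma near_expr_le (R : realType) (t : nat -> nat) (b e : R) :
  (forall n, (0 < t n)%N) -> 0 <= b < 1 -> 0 < e ->
  \forall n \near \oo, b ^+ (t n * n) <= e.
Proof.
move=> t0 /andP[b0 b1] e0.
have : b ^+ n @[n --> \oo] --> 0 by apply: cvg_expr; rewrite ger0_norm.
move=> /cvgrPdist_le/(_ e e0); apply: filterS => n.
rewrite sub0r normrN ger0_norm ?exprn_ge0//; apply: le_trans.
by rewrite ler_wiXn2l// ?(ltW b1)// leq_pmull.
Qed.

(** Square root of [1 + s < exp s]; it makes the upper-tail bound decay geometrically. *)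
Lemma sqrt_1D_expR_lt1 (R : realType) (s : R) : 0 < s ->
  Num.sqrt (1 + s) * expR (- (s / 2)) < 1.
Proof.
move=> s0; rewrite expRN ltr_pdivrMr ?expR_gt0// mul1r.
rewrite -[ltRHS]gtr0_norm ?expR_gt0// -sqrtr_sqr ltr_sqrt ?exprn_gt0 ?expR_gt0//.
by rewrite -expRM_natl mulrC divfK// expR_gt1Dx// gt_eqF.
Qed.

Theorem theoremA2 (R : realType) (t : nat -> nat)
    (t_gt0 : forall n : nat, (0 < t n)%N)
    (t_olog : (fun n : nat => (t n)%:R : R) =o_\oo (fun n : nat => ln (n%:R : R)))
    (disp : nat -> measure_display)
    (Omega : forall n : nat, measurableType (disp n))
    (P : forall n : nat, probability (Omega n) R)
    (Pi : forall n : nat, Omega n -> 'cV[R]_n -> 'cV[R]_(t n))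
    (Pi_jl : forall n : nat, jl_distributed (P n) (Pi n)) :
  exists eps delta : nat -> R,
    [/\ eps n @[n --> \oo] --> (0 : R),
        delta n @[n --> \oo] --> (0 : R) &
        forall n : nat,
          ((1 - delta n)%:E <=
           P n [set w : Omega n |
                 (2 - eps n <=
                 min_cost (@std_basis R n) id (@std_basis R n) /
                 min_cost (@std_basis R n) (Pi n w)
                          (Pi n w @` (@std_basis R n)))%R])%E].
Proof.
(* One sequence serves both as the loss in the ratio and as the failure probability; at [e = 2] the
   probability bound is negative, hence trivial. *)
pose Q n (e : R) : Prop := ((1 - e)%:E <= P n [set w : Omega n | (2 - e <=
    min_cost (@std_basis R n) id (@std_basis R n) /
    min_cost (@std_basis R n) (Pi n w) (Pi n w @` (@std_basis R n)))%R])%E.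
suff [eps eps0 Qeps] : exists2 eps : nat -> R,
    eps n @[n --> \oo] --> (0 : R) & forall n, Q n (eps n).
  by exists eps, eps; split.
apply: (@diagonal_rate R Q) => [n|e /andP[e0 e1]].
  by apply: (@le_trans _ _ 0%E); rewrite ?measure_ge0// lee_fin; lra.
(* Makes [2 - 10 s] equal to [2 - e]; each of the three failure terms then gets a share [e / 3]. *)
pose s := e / 10.
have s0 : 0 < s by rewrite divr_gt0.
have s10 : 0 < s <= 10^-1 by rewrite s0 /s ler_pdivrMr// mulVf.
pose b := Num.sqrt (1 + s) * expR (- (s / 2)).
have Qn n : (0 < n)%N -> 1 <= s * n%:R -> b ^+ (t n * n) <= e / 3 ->
    (4 / 5) ^+ (t n * n) <= e / 3 ->
    expR (- (n%:R * small_ball_lb s ^+ t n)) <= e / 3 -> Q n e.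
  case: n => // n _ sn b1 b2 b3.
  have := jl_ratio_prob_ge R _ _ _ n _ _ s (Pi_jl n.+1) (t_gt0 n.+1) s10 sn.
  have -> : 10 * s = e by rewrite /s; field.
  by apply: le_trans; rewrite lee_fin -/b; lra.
have e3 : 0 < e / 3 by rewrite divr_gt0.
near=> n; apply: Qn.
- by near: n; exact: nbhs_infty_gt.
- rewrite mulrC -ler_pdivrMr// div1r; near: n; exact: nbhs_infty_ger.
- near: n; apply: near_expr_le => //.
  by rewrite mulr_ge0 ?expR_ge0//= sqrt_1D_expR_lt1.
- by near: n; apply: near_expr_le => //; lra.
(* With [x = n q^t], this suffices because [exp x >= 1 + x >= x]. *)
- have : (e / 3)^-1 <= n%:R * small_ball_lb s ^+ t n.
    by near: n; apply: near_le_mul_expr => //; exact: small_ball_lb_gt0.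
  move=> H; rewrite expRN -[leRHS]invrK lef_pV2 ?posrE ?invr_gt0 ?expR_gt0//.
  by apply: (le_trans H); apply: le_trans (expR_ge1Dx _); rewrite lerDr.
Unshelve. all: by end_near. Qed.
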